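(* There is an absolute constant $C>0$ such that for every $\epsilon>0$ and positive integer $m$, with $M=m^{C}\epsilon^{-C\epsilon^{-5}}$, the following holds: for every $n\in\mathbb{N}$ and every $n\times n$ matrix $Y=(y_{ij})$ with entries in $[0,1]$, there is an integer $k\in[m,M]$ such that every equipartition of $[n]$ into $k$ intervals is interval $\epsilon$-regular for $Y$.
   Context: An interval is a subset of $[n]$ of consecutive integers. For intervals $I,J\subseteq[n]$, $d_Y(I,J)=\frac{1}{|I||J|}\sum_{i\in I,j\in J}y_{ij}$. A pair of intervals $(I,J)$ is interval $\epsilon$-regular for $Y$ if for all subintervals $A\subseteq I$, $B\subseteq J$ with $|A|\ge\epsilon|I|$ and $|B|\ge\epsilon|J|$, $|d_Y(A,B)-d_Y(I,J)|\le\epsilon$. A partition $\mathcal{P}$ of $[n]$ into $k$ intervals is interval $\epsilon$-regular for $Y$ if all except at most $\epsilon k^2$ pairs $(I,J)$ of intervals of $\mathcal{P}$ are interval $\epsilon$-regular for $Y$. An equipartition is a partition in which every two parts differ in size by at most one.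
   Formalization: The case m = 1 with ε > 1 is excluded, because there M = ε^{-Cε^{-5}} < 1 for every C > 0, so no integer k lies in [m, M] and the claim as written fails. *)

(* Defs.v *)
From HB Require Import structures.
From mathcomp Require Import all_boot all_order all_algebra.
From mathcomp Require Import reals exp.
Set Implicit Arguments.
Unset Strict Implicit.
Unset Printing Implicit Defensive.
Import Order.TTheory GRing.Theory Num.Theory.
Local Open Scope ring_scope.

(* [n] is 'I_n, i.e. {0, ..., n-1}; a set of consecutive integers is written
   as {a, ..., b-1} with 0 <= a, b <= n (the empty set is a = b). *)
Definition is_ord_interval (n : nat) (A : {set 'I_n}) : bool :=
  [exists a : 'I_n.+1, exists b : 'I_n.+1,
     A == [set i : 'I_n | (a <= i)%N && (i < b)%N]%SET].

Section Regularity.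
Variables (R : realType) (n : nat).
Implicit Types (Y : 'M[R]_n) (I J A B : {set 'I_n}) (P : {set {set 'I_n}}).

Definition density Y I J : R :=
  (\sum_(i in I) \sum_(j in J) Y i j) / (#|I|%:R * #|J|%:R).

Definition interval_regular_pair (eps : R) Y I J : bool :=
  [forall A : {set 'I_n}, forall B : {set 'I_n},
     [&& is_ord_interval A, is_ord_interval B, A \subset I, B \subset J,
         eps * #|I|%:R <= #|A|%:R & eps * #|J|%:R <= #|B|%:R] ==>
     (`|density Y A B - density Y I J| <= eps)].

(* The k ^ 2 pairs are the ordered ones, I = J included. *)
Definition interval_regular_partition (eps : R) Y P : Prop :=
  #|[set p in finset.setX P P | ~~ interval_regular_pair eps Y p.1 p.2]%SET|%:R
    <= eps * #|P|%:R ^+ 2.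

(* [finset.partition] requires the parts to be nonempty. *)
Definition interval_equipartition P : Prop :=
  [/\ finset.partition P [set: 'I_n]%SET,
      {in P, forall I, is_ord_interval I}
    & {in P &, forall I J, (#|I| <= #|J|.+1)%N}].

End Regularity.

(* Main.v *)
Require Import Defs.
From HB Require Import structures.
From mathcomp Require Import all_boot all_order all_algebra.
From mathcomp Require Import reals exp.
From mathcomp Require Import ring lra zify.
Set Implicit Arguments.
Unset Strict Implicit.
Unset Printing Implicit Defensive.
Import Order.TTheory GRing.Theory Num.Theory.
Local Open Scope ring_scope.

(* Cut [n] into k consecutive blocks of real length n/k; the blocks for kt refine
   those for k. The energy of level k is the sum of the squares of Y averaged over
   pairs of blocks; along m, mt, mt^2, ... it increases and stays below n^2, so with
   t ~ 64/eps^2 one of the first 32/eps^5 + 1 steps gains at most (eps^5/32) n^2.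
   That level works. Indeed the a-th part of any equipartition into k intervals
   differs from the a-th block in at most 2k points, and a witness interval of
   irregularity contains, up to a small proportion, a union of blocks of level kt.
   By Cauchy-Schwarz each irregular pair therefore contributes at least
   (eps^4/8)(n/k)^2, up to rounding, to the energy gained from k to kt, and more
   than eps k^2 irregular pairs would contribute too much. This requires n to be
   large compared with the levels; otherwise take k > n, for which there is no
   equipartition. When eps >= 2/3 every pair is regular, as the two densities
   differ by at most 2(1 - eps). *)

(** * Intervals of ['I_n] and the left-to-right order of the parts of a partition *)

Section OrdIntervals.
Variable n : nat.
Implicit Types (A I J X : {set 'I_n}) (P : {set {set 'I_n}}).

Lemma ord_interval_convex A (i j l : 'I_n) :
  is_ord_interval A -> i \in A -> j \in A -> (i <= l <= j)%N -> l \in A.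
Proof.
case/existsP=> a /existsP[b /eqP->]; rewrite !inE => /andP[ai _] /andP[_ jb].
by case/andP=> il lj; rewrite (leq_trans ai il) (leq_ltn_trans lj jb).
Qed.

Lemma card_ord_lt (l : nat) : (l <= n)%N -> #|[set i : 'I_n | (i < l)%N]%SET| = l.
Proof.
move=> ln; rewrite -sum1dep_card -(big_ord_widen n (fun _ => 1%N)) //.
by rewrite sum1_card card_ord.
Qed.

Lemma card_ord_window X (u w : nat) :
  {in X, forall i : 'I_n, (u <= i < u + w)%N} -> (#|X| <= w)%N.
Proof.
move=> Xw; rewrite cardE -(size_map val) -[leqRHS](size_iota u).
apply: uniq_leq_size; first by rewrite (map_inj_uniq val_inj) enum_uniq.
by move=> _ /mapP[i + ->]; rewrite mem_enum mem_iota => /Xw.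
Qed.

Lemma card_ord_convex X (i j : 'I_n) :
  is_ord_interval X -> i \in X -> j \in X -> (i <= j)%N -> (j - i < #|X|)%N.
Proof.
move=> cX iX jX ij.
have /subset_leq_card : [set l : 'I_n | (l < j.+1)%N]%SET \subset
    X :|: [set l : 'I_n | (l < i)%N]%SET.
  apply/subsetP => l; rewrite !inE ltnS => lj.
  case: (ltnP l i) => [|il]; first by rewrite orbT.
  by rewrite (ord_interval_convex cX iX jX) // il.
move/leq_trans/(_ (leq_card_setU _ _)); rewrite !card_ord_lt //; last exact: ltnW.
by rewrite addnC ltn_subLR.
Qed.

(** [n] is the default value on the empty set. *)
Definition set_min I : nat :=
  if [pick i in I] is Some i0 then [arg min_(i < i0 in I) (i : nat)] else n.

Variant set_min_spec I : nat -> Prop :=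
  SetMinSpec i of i \in I & {in I, forall j : 'I_n, (i <= j)%N} :
    set_min_spec I (nat_of_ord i).

Lemma set_minP I : I != finset.set0 -> set_min_spec I (set_min I).
Proof.
case/set0Pn=> x xI; rewrite /set_min; case: pickP => [i0 i0I|/(_ x)]; last first.
  by rewrite xI.
by case: arg_minnP => // i iI imin; split.
Qed.

(** The position of [I] among the parts from left to right, counted from 0; it decides which block
    [I] is compared with. *)
Definition part_rank P I : nat := #|[set J in P | set_min J < set_min I]%N%SET|.

Section Ranks.
Variable P : {set {set 'I_n}}.
Hypothesis partP : finset.partition P [set: 'I_n]%SET.
Hypothesis intP : {in P, forall I, is_ord_interval I}.

Lemma part_neq0 I : I \in P -> I != finset.set0.
Proof. by case/and3P: partP => _ _ N0; apply: contraTneq => ->. Qed.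

Lemma part_eq I J i : I \in P -> J \in P -> i \in I -> i \in J -> I = J.
Proof.
case/and3P: partP => _ tP _ IP JP iI iJ.
by rewrite -(def_pblock tP IP iI) (def_pblock tP JP iJ).
Qed.

Lemma card_part_le : (#|P| <= n)%N.
Proof.
rewrite -[leqRHS]card_ord -cardsT (card_partition partP) -sum1_card.
by apply: leq_sum => I /part_neq0; rewrite card_gt0.
Qed.

Lemma part_rank_inj : {in P &, injective (part_rank P)}.
Proof.
have lt_rank I J : I \in P -> (set_min I < set_min J)%N ->
    (part_rank P I < part_rank P J)%N.
  move=> IP IJ; apply: proper_card; apply/properP; split.
    by apply/subsetP => K; rewrite !inE => /andP[-> /ltn_trans->].
  by exists I; rewrite !inE IP ?IJ ?ltnn.
move=> I J IP JP eq_rank.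
case: (ltngtP (set_min I) (set_min J)) => [/lt_rank|/lt_rank|].
- by move/(_ IP); rewrite eq_rank ltnn.
- by move/(_ JP); rewrite eq_rank ltnn.
case: (set_minP (part_neq0 IP)) => i iI _.
case: (set_minP (part_neq0 JP)) => j jJ _ /val_inj ij.
by apply: (part_eq IP JP iI); rewrite ij.
Qed.

Lemma part_rank_lt I : I \in P -> (part_rank P I < #|P|)%N.
Proof.
move=> IP; apply: proper_card; apply/properP; split.
  by apply/subsetP => K; rewrite !inE => /andP[].
by exists I; rewrite // !inE ltnn andbF.
Qed.

(** The parts that begin before [I] tile the points below its minimum: by convexity, one that
    reached further would contain the minimum of [I]. *)
Lemma set_min_sum I : I \in P ->
  set_min I = (\sum_(J in [set J in P | set_min J < set_min I]%N%SET) #|J|)%N.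
Proof.
move=> IP; case/and3P: (partP) => /eqP covP tP _.
set Q := [set J in _ | _]%SET.
have tQ : finset.trivIset Q.
  by apply: (trivIsetS _ tP); apply/subsetP => J; rewrite inE => /andP[].
rewrite (eqP tQ).
suff -> : cover Q = [set i : 'I_n | (i < set_min I)%N]%SET.
  by rewrite card_ord_lt //; case: (set_minP (part_neq0 IP)) => i _ _; apply: ltnW.
apply/setP => i; rewrite inE; apply/bigcupP/idP => [[J]|lt_i].
  rewrite !inE => /andP[JP ltJI iJ].
  rewrite ltnNge; apply/negP => leIi.
  suff eIJ : I = J by rewrite eIJ ltnn in ltJI.
  case: (set_minP (part_neq0 IP)) leIi ltJI => x xI _ leIi.
  case: (set_minP (part_neq0 JP)) => y yJ _ ltyx.
  apply: (part_eq IP JP xI).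
  by apply: (ord_interval_convex (intP JP) yJ iJ); rewrite (ltnW ltyx).
have : i \in cover P by rewrite covP inE.
case/bigcupP=> J JP iJ; exists J => //; rewrite inE JP /=.
case: (set_minP (part_neq0 JP)) => j _ /(_ i iJ) ji.
exact: leq_ltn_trans ji lt_i.
Qed.

End Ranks.

(** * Blocks of real length [n / k] and their refinement *)

(* [block k i] is the index of the cell containing [i] when [0, n) is cut into
   [k] half-open intervals of real length [n / k]. *)
Definition block (k : nat) (i : 'I_n) : nat := (i * k %/ n)%N.

Definition block_set (k a : nat) : {set 'I_n} := [set i | block k i == a]%SET.

Lemma block_refine k t (i : 'I_n) : (0 < t)%N -> block k i = (block (k * t) i %/ t)%N.
Proof. by move=> t0; rewrite /block mulnA -divnMA divnMr. Qed.

Lemma mem_block_set k a (i : 'I_n) :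
  (i \in block_set k a) = (a * n <= i * k < a.+1 * n)%N.
Proof.
have n0 : (0 < n)%N by exact: leq_ltn_trans (ltn_ord i).
by rewrite inE /block eqn_leq -ltnS ltn_divLR // leq_divRL // andbC.
Qed.

Lemma block_set_convex k a (i j l : 'I_n) :
  i \in block_set k a -> j \in block_set k a -> (i <= l <= j)%N ->
  l \in block_set k a.
Proof.
rewrite !mem_block_set => /andP[ai _] /andP[_ ja] /andP[il lj].
rewrite (leq_trans ai) ?leq_mul2r ?il ?orbT //.
by rewrite (leq_ltn_trans _ ja) ?leq_mul2r ?lj ?orbT.
Qed.

Lemma card_block_set k a : (0 < k)%N -> (#|block_set k a| <= (n %/ k).+1)%N.
Proof.
move=> k0; have [->|/set_minP[u ub umin]] := eqVneq (block_set k a) finset.set0.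
  by rewrite cards0.
apply: (@card_ord_window _ u) => i ib; rewrite umin //=.
move: ub ib; rewrite !mem_block_set => /andP[au _] /andP[_ ia].
rewrite addnS ltnS -leq_subLR leq_divRL // mulnBl; lia.
Qed.

(** * Comparison of the parts of an equipartition with the blocks *)

Section InnerApproximation.
Variables (P : {set {set 'I_n}}) (k s : nat).
Hypothesis partP : finset.partition P [set: 'I_n]%SET.
Hypothesis intP : {in P, forall I, is_ord_interval I}.
Hypothesis cardP : #|P| = k.
Hypothesis sizeP : {in P, forall I, (s <= #|I| <= s.+1)%N}.

Lemma card_ord_bounds : (k * s <= n <= k * s.+1)%N.
Proof.
have nE : n = (\sum_(I in P) #|I|)%N.
  by rewrite -(card_partition partP) cardsT card_ord.
rewrite nE -cardP -!sum_nat_const.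
by apply/andP; split; apply: leq_sum => I /sizeP/andP[].
Qed.

Lemma set_min_bounds I : I \in P ->
  (part_rank P I * s <= set_min I <= part_rank P I * s.+1)%N.
Proof.
move=> IP; rewrite (set_min_sum partP intP IP) /part_rank -!sum_nat_const.
by apply/andP; split; apply: leq_sum => J; rewrite inE => /andP[/sizeP/andP[]].
Qed.

Lemma mem_part_window I (i : 'I_n) : I \in P ->
  (i \in I) = (set_min I <= i < set_min I + #|I|)%N.
Proof.
move=> IP; case: (set_minP (part_neq0 partP IP)) => x xI xmin.
apply/idP/idP => [iI|/andP[xi ix]].
  rewrite xmin //= -ltn_subLR ?xmin //.
  exact: card_ord_convex (intP IP) xI iI (xmin _ iI).
(* If [i] is not in [I], convexity keeps [I] below [i], so [I] has at most [i - x] points. *)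
apply: contraLR ix => iNI; rewrite -leqNgt -leq_subRL //.
apply: (@card_ord_window _ x) => j jI; rewrite xmin //= subnKC //.
rewrite ltnNge; apply: contra iNI => ij.
by apply: (ord_interval_convex (intP IP) xI jI); rewrite xi.
Qed.

(* Both ends of the part of rank [a] and of the [a]-th block lie in the windows
   [[a s, a (s+1)]] and [[(a+1) s, (a+1) (s+1)]], so that the two sets
   can only differ there. *)
Lemma part_block_diff I (i : 'I_n) : I \in P ->
  let a := part_rank P I in
  (i \in I) != (i \in block_set k a) ->
  ((a * s <= i < a * s + a) || (a.+1 * s <= i < a.+1 * s + a.+1))%N.
Proof.
move=> IP a; have /andP[kn nk] := card_ord_bounds.
have /andP[m1 m2] : (a * s <= set_min I <= a * s.+1)%N := set_min_bounds IP.
have [c [s1 s2 ->]] : exists c, [/\ (s <= c)%N, (c <= s.+1)%N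
    & (i \in I) = (set_min I <= i < set_min I + c)%N].
  by exists #|I|; case/andP: (sizeP IP); split=> //; apply: mem_part_window.
have ak : (a < k)%N by rewrite -cardP; exact: part_rank_lt.
rewrite mem_block_set.
have k0 : (0 < k)%N by lia.
(* The boundary [b n / k] lies between [b s] and [b (s + 1)], since [k s <= n <= k (s + 1)]. *)
have lo b : (b * n <= i * k -> b * s <= i)%N.
  move=> h; rewrite -(leq_pmul2r k0); apply: leq_trans h; nia.
have hi b : (i * k < b * n -> i < b * s + b)%N.
  move=> h; rewrite -(ltn_pmul2r k0); apply: leq_trans h _; nia.
have := lo a; have := lo a.+1; have := hi a; have := hi a.+1.
rewrite !mulSn mulnS in m1 m2 *.
case: (leqP (a * n) (i * k)); case: (ltnP (i * k) (n + a * n));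
case: (leqP (set_min I) i); case: (ltnP i (set_min I + c)) => //= *; lia.
Qed.

(** The two windows of [part_block_diff] have at most [a] and [a + 1] points, and [a < k]. *)
Lemma card_part_block_diff I : I \in P ->
  let B := block_set k (part_rank P I) in
  (#|I :\: B| <= 2 * k)%N /\ (#|B :\: I| <= 2 * k)%N.
Proof.
move=> IP B; set a := part_rank P I.
have ak : (a < k)%N by rewrite -cardP; exact: part_rank_lt.
pose W u w := [set i : 'I_n | (u <= i < u + w)%N]%SET.
have cW u w : (#|W u w| <= w)%N by apply: (@card_ord_window _ u) => i; rewrite inE.
have c2 : (#|W (a * s) a :|: W (a.+1 * s) a.+1| <= 2 * k)%N.
  apply: leq_trans (leq_card_setU _ _) _.
  by have := cW (a * s)%N a; have := cW (a.+1 * s)%N a.+1; lia.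
split; apply: leq_trans c2; apply: subset_leq_card; apply/subsetP => i;
  rewrite !in_setD => /andP[iN iY]; rewrite !inE; apply: part_block_diff => //.
  by rewrite iY (negPf iN).
by rewrite -/a -/B iY (negPf iN).
Qed.

(** [A'] is the union of the blocks of level [k t] that lie in [A] and in the block of [I]. A point
    of [A] is lost if it lies outside the block of [I], or if its fine block sticks out of [A] and
    so contains an end of [A]; this gives the two terms. *)
Lemma inner_approximation I A t : I \in P -> (0 < t)%N ->
  is_ord_interval A -> A \subset I -> A != finset.set0 ->
  exists A' : {set 'I_n},
    [/\ A' \subset A, A' \subset block_set k (part_rank P I),
        forall i j, block (k * t) i = block (k * t) j -> i \in A' -> j \in A'
      & (#|A :\: A'| <= 2 * k + 2 * (n %/ (k * t)).+1)%N].
Proof.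
move=> IP t0 intA AI A0; set B := block_set k (part_rank P I).
have k0 : (0 < k)%N by rewrite -cardP; apply/card_gt0P; exists I.
have [x xA xmin] := set_minP A0.
have [y yA ymax] : exists2 y, y \in A & {in A, forall j : 'I_n, (j <= y)%N}.
  by case: (arg_maxnP (fun i : 'I_n => i : nat) xA) => y yA ymax; exists y.
pose c (i : 'I_n) := block_set (k * t) (block (k * t) i).
exists [set i | c i \subset A :&: B]%SET; split.
- by apply/subsetP => i; rewrite inE subsetI => /andP[/subsetP/(_ i)-> //]; rewrite inE.
- by apply/subsetP => i; rewrite inE subsetI => /andP[_ /subsetP/(_ i)-> //]; rewrite inE.
- by move=> i j eij; rewrite !inE /c eij.
have sub : A :\: [set i | c i \subset A :&: B]%SET \subset (I :\: B) :|: (c x :|: c y).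
  apply/subsetP => i; rewrite !in_setD in_set => /andP[ciN iA].
  rewrite !in_setU in_setD (subsetP AI) // andbT.
  case: (boolP (i \in B)) => //= iB; move: ciN.
  (* Blocks of level [k t] refine those of level [k], so the fine block of a point of [B] stays in
     [B]. *)
  have -> : c i \subset A :&: B = (c i \subset A).
    rewrite subsetI; case: (c i \subset A) => //=; apply/subsetP => j.
    by rewrite !inE (block_refine k j t0) => /eqP->; rewrite -block_refine // -(in_set (fun i => block k i == _)).
  case/subsetPn=> l lc lNA.
  have ic : i \in c i by rewrite inE.
  have [lx|xl] := ltnP l x.
    have : x \in c i by apply: (block_set_convex lc ic); rewrite (ltnW lx) xmin.
    by rewrite !inE => /eqP->; rewrite eqxx.
  have [yl|ly] := ltnP y l.
    have : y \in c i by apply: (block_set_convex ic lc); rewrite (ltnW yl) ymax.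
    by rewrite !inE => /eqP->; rewrite eqxx orbT.
  by case/negP: lNA; apply: (ord_interval_convex intA xA yA); rewrite xl.
apply: leq_trans (subset_leq_card sub) _; apply: leq_trans (leq_card_setU _ _) _.
apply: leq_add; first by case: (card_part_block_diff IP).
apply: leq_trans (leq_card_setU _ _) _; rewrite mul2n -addnn.
by apply: leq_add; apply: card_block_set; rewrite muln_gt0 k0.
Qed.

End InnerApproximation.
End OrdIntervals.

(** * Means over the classes of a labelling, and their energy *)

Section Averages.
Variables (R : realFieldType) (T : finType) (F : T -> R).
Hypothesis F01 : forall x, 0 <= F x <= 1.
Implicit Types (X Z : {set T}) (L : eqType).

Definition mean X : R := (\sum_(x in X) F x) / #|X|%:R.

Lemma mean_cardM X : mean X * #|X|%:R = \sum_(x in X) F x.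
Proof.
have [->|X0] := eqVneq X finset.set0; first by rewrite cards0 mulr0 big_set0.
by rewrite /mean divfK // pnatr_eq0 cards_eq0.
Qed.

Lemma sum_bounds X : 0 <= \sum_(x in X) F x <= #|X|%:R.
Proof.
rewrite sumr_ge0 /=; last by move=> x _; case/andP: (F01 x).
by rewrite -sum1_card natr_sum; apply: ler_sum => x _; case/andP: (F01 x).
Qed.

Lemma mean_bounds X : 0 <= mean X <= 1.
Proof.
have /andP[S0 S1] := sum_bounds X.
rewrite divr_ge0 //=; have [->|X0] := eqVneq X finset.set0.
  by rewrite /mean cards0 invr0 mulr0 ler01.
by rewrite ler_pdivrMr ?mul1r // ltr0n card_gt0.
Qed.

(** Multiplied by [|Z|], the difference is [mean X * |Z :\: X|] minus the sum over [Z :\: X], and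
    both terms lie in [[0, |Z :\: X|]]. *)
Lemma mean_subset X Z : X \subset Z ->
  `|mean X - mean Z| <= #|Z :\: X|%:R / #|Z|%:R.
Proof.
move=> XZ; have [Z0|Z0] := eqVneq Z finset.set0.
  move: XZ; rewrite Z0 subset0 => /eqP->.
  by rewrite subrr normr0 divr_ge0.
have cZ : 0 < #|Z|%:R :> R by rewrite ltr0n card_gt0.
rewrite ler_pdivlMr // -(gtr0_norm cZ) -normrM mulrBl mean_cardM.
have /andP[m0 m1] := mean_bounds X.
have /andP[r0 r1] := sum_bounds (Z :\: X).
have -> : \sum_(x in Z) F x = mean X * #|X|%:R + \sum_(x in Z :\: X) F x.
  by rewrite mean_cardM (big_setID X) /= (setIidPr XZ).
have -> : #|Z|%:R = #|X|%:R + #|Z :\: X|%:R :> R.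
  by rewrite -natrD -(cardsID X Z) (setIidPr XZ).
rewrite mulrDr opprD addrACA subrr add0r.
have : 0 <= mean X * #|Z :\: X|%:R <= #|Z :\: X|%:R.
  by rewrite mulr_ge0 //= ler_piMl.
rewrite ler_norml; lra.
Qed.

Definition class_mean L (b : T -> L) x : R := mean [set y | b y == b x]%SET.

Lemma class_mean_eq L (b : T -> L) x y :
  b x = b y -> class_mean b x = class_mean b y.
Proof. by rewrite /class_mean => ->. Qed.

(* [class_mean b] is the orthogonal projection of [F] on the functions that are
   constant on the classes of [b]. *)
Lemma sum_class_mean L (b : T -> L) (h : T -> R) :
  (forall x y, b x = b y -> h x = h y) ->
  \sum_x h x * class_mean b x = \sum_x h x * F x.
Proof.
move=> hb; pose N x : R := #|[set y | b y == b x]%SET|%:R.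
have -> : \sum_x h x * class_mean b x = \sum_x \sum_(y | b x == b y) h y * F y / N y.
  apply: eq_bigr => x _; rewrite /class_mean /mean mulrA mulr_sumr mulr_suml.
  apply: eq_big => [y|y]; first by rewrite inE eq_sym.
  by rewrite inE => /eqP e; rewrite /N e (hb _ _ e).
(* After the exchange [y] appears once for each member of its class, which cancels the denominator
   [N y]. *)
rewrite (exchange_big_dep xpredT) //=; apply: eq_bigr => y _.
rewrite sumr_const -cardsE -/(N y) -mulr_natr divfK //.
by rewrite pnatr_eq0 cards_eq0; apply/set0Pn; exists y; rewrite inE.
Qed.

(** This is [sum_class_mean] with the indicator of [X] as [h]. *)
Lemma sum_class_mean_closed L (b : T -> L) X :
  (forall x y, b x = b y -> x \in X -> y \in X) ->
  \sum_(x in X) class_mean b x = \sum_(x in X) F x.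
Proof.
move=> Xb; have Xe x y : b x = b y -> (x \in X) = (y \in X).
  by move=> e; apply/idP/idP; apply: Xb.
rewrite [LHS]big_mkcond [RHS]big_mkcond /=.
rewrite (eq_bigr (fun x => (x \in X)%:R * class_mean b x)) => [|x _]; last first.
  by case: (x \in X); rewrite ?mul1r ?mul0r.
rewrite sum_class_mean => [|x y /Xe -> //].
by apply: eq_bigr => x _; case: (x \in X); rewrite ?mul1r ?mul0r.
Qed.

(** Summing over points weights each class by its size. *)
Definition energy L (b : T -> L) : R := \sum_x class_mean b x ^+ 2.

Lemma energy_bounds L (b : T -> L) : 0 <= energy b <= #|T|%:R.
Proof.
rewrite sumr_ge0 /=; last by move=> x _; exact: sqr_ge0.
rewrite -sum1_card natr_sum; apply: ler_sum => x _.
by have /andP[? ?] := mean_bounds [set y | b y == b x]%SET; rewrite expr_le1.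
Qed.

Definition energy_gap L1 L2 (b : T -> L1) (c : T -> L2) : R :=
  \sum_x (class_mean c x - class_mean b x) ^+ 2.

(** Pythagoras for nested projections. The cross term is [energy b]: [class_mean b] is constant on
    the classes of [c], so [class_mean c] may be replaced by [F], and then [F] by [class_mean b]. *)
Lemma energy_gapE L1 L2 (b : T -> L1) (c : T -> L2) :
  (forall x y, c x = c y -> b x = b y) ->
  energy_gap b c = energy c - energy b.
Proof.
move=> cb.
have e1 : \sum_x class_mean b x * class_mean c x = energy b.
  rewrite sum_class_mean => [|x y /cb]; last exact: class_mean_eq.
  by rewrite -(sum_class_mean (@class_mean_eq _ b)).
transitivity (energy c + energy b - (\sum_x class_mean b x * class_mean c x) *+ 2).
  rewrite /energy_gap /energy -sumrMnl -big_split -sumrB /=.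
  by apply: eq_bigr => x _; ring.
by rewrite e1; ring.
Qed.

(** Cauchy-Schwarz, from the nonnegativity of the sum of [(N f - S)^2]. *)
Lemma sum_sqr_ge (f : T -> R) X :
  (\sum_(x in X) f x) ^+ 2 <= #|X|%:R * \sum_(x in X) f x ^+ 2.
Proof.
have [->|X0] := eqVneq X finset.set0; first by rewrite !big_set0 cards0 mul0r expr0n.
have cX : 0 < #|X|%:R :> R by rewrite ltr0n card_gt0.
set S := \sum_(x in X) f x; set N := #|X|%:R in cX *.
have : 0 <= \sum_(x in X) (N * f x - S) ^+ 2 by apply: sumr_ge0 => x _; exact: sqr_ge0.
have -> : \sum_(x in X) (N * f x - S) ^+ 2 =
    N * (N * \sum_(x in X) f x ^+ 2 - S ^+ 2).
  transitivity (N ^+ 2 * (\sum_(x in X) f x ^+ 2)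
      - N * S *+ 2 * (\sum_(x in X) f x) + \sum_(x in X) S ^+ 2).
    rewrite 2!mulr_sumr -sumrB -big_split /=.
    by apply: eq_bigr => x _; ring.
  by rewrite sumr_const -mulr_natr -/S -/N; ring.
by rewrite pmulr_rge0 // subr_ge0.
Qed.

(** Over [X], a union of classes of [c] inside one class of [b], the difference of the two class
    means sums to [|X| (mean X - mean Z)]; Cauchy-Schwarz turns this into a lower bound for the
    squares. *)
Lemma class_gain L1 L2 (b : T -> L1) (c : T -> L2) (X Z : {set T}) (v : L1) :
  Z = [set x | b x == v]%SET -> X \subset Z ->
  (forall x y, c x = c y -> x \in X -> y \in X) ->
  #|X|%:R * (mean X - mean Z) ^+ 2 <=
    \sum_(x | b x == v) (class_mean c x - class_mean b x) ^+ 2.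
Proof.
move=> ZE XZ Xc; set f := fun x => class_mean c x - class_mean b x.
have bZ x : x \in Z -> class_mean b x = mean Z.
  by rewrite ZE inE /class_mean => /eqP ->.
apply: (@le_trans _ _ (\sum_(x in X) f x ^+ 2)); last first.
  have -> : \sum_(x | b x == v) f x ^+ 2 = \sum_(x in Z) f x ^+ 2.
    by apply: eq_bigl => x; rewrite ZE inE.
  rewrite [leRHS](big_setID X) /= (setIidPr XZ) lerDl.
  by apply: sumr_ge0 => x _; exact: sqr_ge0.
have [->|X0] := eqVneq X finset.set0; first by rewrite cards0 mul0r big_set0.
have cX : 0 < #|X|%:R :> R by rewrite ltr0n card_gt0.
have := sum_sqr_ge f X.
have -> : \sum_(x in X) f x = #|X|%:R * (mean X - mean Z).
  rewrite sumrB sum_class_mean_closed // -mean_cardM.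
  rewrite (eq_bigr (fun=> mean Z)) => [|x /(subsetP XZ)/bZ //].
  by rewrite sumr_const -mulr_natr; ring.
by rewrite exprMn expr2 -mulrA ler_pM2l.
Qed.

End Averages.

(** * Stability of densities under passing to large subsets *)

Section Densities.
Variables (R : realType) (n : nat) (Y : 'M[R]_n).
Hypothesis Y01 : forall i j, 0 <= Y i j <= 1.
Implicit Types (I J A B : {set 'I_n}).

Lemma density_mean I J :
  density Y I J = mean (fun p => Y p.1 p.2) (finset.setX I J).
Proof.
rewrite /density /mean cardsX natrM pair_big_dep /=; congr (_ / _).
by apply: eq_bigl => p; rewrite inE.
Qed.

(** The pairs lost from [I x J] lie in [(I :\: A) x J] or in [I x (J :\: B)]. *)
Lemma density_subset I J A B : A \subset I -> B \subset J ->
  `|density Y A B - density Y I J| <=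
    #|I :\: A|%:R / #|I|%:R + #|J :\: B|%:R / #|J|%:R.
Proof.
move=> AI BJ; rewrite !density_mean.
have F01 (p : 'I_n * 'I_n) : 0 <= Y p.1 p.2 <= 1 by exact: Y01.
apply: le_trans (mean_subset F01 (setXS AI BJ)) _.
have [->|I0] := eqVneq I finset.set0.
  by rewrite cardsX cards0 mul0n invr0 mulr0 addr_ge0 ?mulr_ge0 ?invr_ge0.
have [->|J0] := eqVneq J finset.set0.
  by rewrite cardsX cards0 muln0 invr0 mulr0 addr_ge0 ?mulr_ge0 ?invr_ge0.
have cI : 0 < #|I|%:R :> R by rewrite ltr0n card_gt0.
have cJ : 0 < #|J|%:R :> R by rewrite ltr0n card_gt0.
rewrite cardsX natrM ler_pdivrMr ?mulr_gt0 //.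
have -> : (#|I :\: A|%:R / #|I|%:R + #|J :\: B|%:R / #|J|%:R) * (#|I|%:R * #|J|%:R)
    = (#|I :\: A| * #|J| + #|I| * #|J :\: B|)%N%:R :> R.
  by rewrite natrD !natrM; field; rewrite !gt_eqF.
rewrite ler_nat -!cardsX; apply: leq_trans (leq_card_setU _ _).
apply: subset_leq_card; apply/subsetP => p.
rewrite !inE negb_and => /andP[/orP[->|->] /andP[-> ->]] //=.
by rewrite orbT.
Qed.

Lemma density_subset_ratio I J A B (r1 r2 : R) : A \subset I -> B \subset J ->
  #|I :\: A|%:R <= r1 * #|I|%:R -> #|J :\: B|%:R <= r2 * #|J|%:R ->
  0 <= r1 -> 0 <= r2 ->
  `|density Y A B - density Y I J| <= r1 + r2.
Proof.
move=> AI BJ h1 h2 r10 r20; apply: le_trans (density_subset AI BJ) _.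
have q (X Z : {set 'I_n}) (r : R) : 0 <= r -> #|X|%:R <= r * #|Z|%:R -> #|X|%:R / #|Z|%:R <= r.
  move=> r0 h; have [->|Z0] := eqVneq Z finset.set0.
    by rewrite cards0 invr0 mulr0.
  by rewrite ler_pdivrMr // ltr0n card_gt0.
by apply: lerD; apply: q.
Qed.

Lemma regular_pair_of_ge (eps : R) I J : 2 <= 3 * eps ->
  I != finset.set0 -> J != finset.set0 -> interval_regular_pair eps Y I J.
Proof.
move=> e23 I0 J0; apply/forallP => A; apply/forallP => B; apply/implyP.
case/and5P=> _ _ AI BJ /andP[cA cB].
(* For [eps > 1] the size condition fails on nonempty sets, so [eps <= 1] comes with the witness. *)
have diff (X Z : {set 'I_n}) : Z != finset.set0 -> X \subset Z -> eps * #|Z|%:R <= #|X|%:R ->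
    eps <= 1 /\ #|Z :\: X|%:R <= (1 - eps) * #|Z|%:R.
  move=> Z0 XZ cX.
  have cZ : 0 < #|Z|%:R :> R by rewrite ltr0n card_gt0.
  have e : #|Z|%:R = #|X|%:R + #|Z :\: X|%:R :> R.
    by rewrite -natrD -(cardsID X Z) (setIidPr XZ).
  have d0 : 0 <= #|Z :\: X|%:R :> R by [].
  split; last by lra.
  by rewrite -(ler_pM2r cZ); lra.
have [e1 dA] := diff _ _ I0 AI cA; have [_ dB] := diff _ _ J0 BJ cB.
apply: (le_trans (density_subset_ratio AI BJ dA dB _ _)); lra.
Qed.

End Densities.

(** * Energy gained from irregular pairs *)

Definition block2 (n k : nat) (p : 'I_n * 'I_n) : nat * nat :=
  (block k p.1, block k p.2).

Lemma block2_refine n k t (p q : 'I_n * 'I_n) : (0 < t)%N ->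
  block2 (k * t) p = block2 (k * t) q -> block2 k p = block2 k q.
Proof.
by move=> t0 [e1 e2]; congr (_, _); rewrite !(block_refine k _ t0) ?e1 ?e2.
Qed.

Section Increment.
Variables (R : realType) (n : nat) (Y : 'M[R]_n) (eps : R).
Hypothesis Y01 : forall i j, 0 <= Y i j <= 1.
Hypothesis eps_gt0 : 0 < eps.
Hypothesis eps_le1 : eps <= 1.
Variables (P : {set {set 'I_n}}) (k t s : nat).
Hypothesis partP : finset.partition P [set: 'I_n]%SET.
Hypothesis intP : {in P, forall I, is_ord_interval I}.
Hypothesis cardP : #|P| = k.
Hypothesis sizeP : {in P, forall I : {set 'I_n}, (s <= #|I| <= s.+1)%N}.
Hypothesis k_gt0 : (0 < k)%N.
Hypothesis t_large : 64 <= eps ^+ 2 * t%:R.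
Hypothesis s_large : (k * t <= s)%N.

Let F (p : 'I_n * 'I_n) : R := Y p.1 p.2.
Let f p := class_mean F (block2 (k * t)) p - class_mean F (block2 k) p.

Lemma t_ge64 : (64 <= t)%N.
Proof.
rewrite -(ler_nat R); apply: le_trans t_large _.
by rewrite ler_piMl // expr_le1 // ltW.
Qed.

Lemma s_ge64 : (64 <= s)%N.
Proof.
apply: leq_trans s_large; apply: leq_trans t_ge64 _.
by rewrite leq_pmull.
Qed.

(** [d / s <= c / t <= c eps^2 / 64]: the form in which the size of [t] enters the estimates of lost
    points. *)
Lemma ratio_small (d c : nat) (r : R) :
  (t * d <= c * s)%N -> c%:R <= 64 * r -> d%:R <= r * eps ^+ 2 * s%:R.
Proof.
rewrite -(ler_nat R) !natrM => h cr.
have s0 : 0 <= s%:R :> R by [].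
have e2 : 0 < eps ^+ 2 by rewrite exprn_gt0.
rewrite -(ler_pM2l (_ : 0 < 64 :> R)) //.
apply: (@le_trans _ _ (eps ^+ 2 * t%:R * d%:R)); first by rewrite ler_wpM2r.
rewrite -mulrA; apply: (@le_trans _ _ (eps ^+ 2 * (c%:R * s%:R))).
  by rewrite ler_pM2l.
have -> : 64 * (r * eps ^+ 2 * s%:R) = eps ^+ 2 * (64 * r * s%:R) by ring.
by rewrite ler_pM2l // ler_wpM2r.
Qed.

(** [A] has at least [eps s] points and loses at most [8 s / t <= eps^2 s / 8] of them in the inner
    approximation. *)
Lemma approximate_side I A : I \in P ->
  is_ord_interval A -> A \subset I -> eps * #|I|%:R <= #|A|%:R ->
  exists A' : {set 'I_n},
    [/\ A' \subset A, A' \subset block_set n k (part_rank P I),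
        forall i j, block (k * t) i = block (k * t) j -> i \in A' -> j \in A',
        #|A :\: A'|%:R <= eps / 8 * #|A|%:R
      & 7 / 8 * eps * s%:R <= #|A'|%:R].
Proof.
move=> IP intA AI cA.
have /andP[sI Is] := sizeP IP.
have sA : eps * s%:R <= #|A|%:R by apply: le_trans cA; rewrite ler_pM2l // ler_nat.
have s64 := s_ge64.
have A0 : A != finset.set0.
  rewrite -card_gt0 -(ltr0n R); apply: lt_le_trans sA; rewrite mulr_gt0 // ltr0n.
  exact: leq_trans s64.
have t0 : (0 < t)%N by exact: leq_trans t_ge64.
have [A' [A'A A'B A'c dA]] := inner_approximation partP intP cardP sizeP IP t0 intA AI A0.
have dA8 : #|A :\: A'|%:R <= eps / 8 * #|A|%:R.
  apply: (@le_trans _ _ (1 / 8 * eps ^+ 2 * s%:R)); last first.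
    rewrite expr2 mulrA -mulrA.
    have -> : 1 / 8 * eps = eps / 8 by ring.
    by rewrite ler_pM2l // divr_gt0.
  (* The constant 8: [t] times the loss is at most [2 k t + 2 t + 2 (s + 1) <= 6 s + 2 <= 8 s]. *)
  apply: (@ratio_small _ 8); last by lra.
  apply: (@leq_trans (t * (2 * k + 2 * (n %/ (k * t)).+1))).
    by rewrite leq_mul2l dA orbT.
  have q : (t * (n %/ (k * t)) <= s.+1)%N.
    have /andP[_ nk] := card_ord_bounds partP cardP sizeP.
    rewrite -(leq_pmul2l k_gt0) mulnA mulnC.
    exact: leq_trans (leq_trunc_div n (k * t)) nk.
  have kt : (t <= k * t)%N by rewrite leq_pmull.
  rewrite mulnDr (mulnCA t 2 k) (mulnCA t 2) mulnS (mulnC t k).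
  apply: (@leq_trans (2 * s + 2 * (s + s.+1))).
    by rewrite leq_add ?leq_mul ?leq_add // (leq_trans kt).
  by clear -s64; lia.
exists A'; split=> //.
have : #|A|%:R = #|A'|%:R + #|A :\: A'|%:R :> R.
  by rewrite -natrD -(cardsID A' A) (setIidPr A'A).
have : eps * #|A|%:R <= #|A|%:R by rewrite ler_piMl.
have : 0 <= #|A|%:R :> R by [].
lra.
Qed.

(** The differences have at most [2 k <= eps s / 32] points. For [B] the constant doubles, because
    only [s <= 2 |B|] is at hand. *)
Lemma part_block_ratios I : I \in P ->
  let B := block_set n k (part_rank P I) in
  #|I :\: (I :&: B)|%:R <= eps / 32 * #|I|%:R /\
  #|B :\: (I :&: B)|%:R <= eps / 16 * #|B|%:R.
Proof.
move=> IP B; have [d1 d2] := card_part_block_diff partP intP cardP sizeP IP.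
rewrite -/B in d1 d2.
have /andP[sI _] := sizeP IP.
have e2 : eps ^+ 2 <= eps by rewrite expr2 ler_piMl // ltW.
have small (d : nat) : (d <= 2 * k)%N -> d%:R <= eps / 32 * s%:R :> R.
  move=> dk; apply: (@le_trans _ _ (1 / 32 * eps ^+ 2 * s%:R)).
    apply: (@ratio_small _ 2); last by lra.
    apply: leq_trans (leq_mul (leqnn t) dk) _.
    by rewrite mulnCA leq_mul2l /= mulnC.
  by rewrite ler_wpM2r //; lra.
have lin (x y z b : R) : s%:R <= x -> x = y + z -> y <= b ->
    z <= eps / 32 * s%:R -> s%:R <= 2 * b.
  have : eps / 32 * s%:R <= 1 / 2 * s%:R.
    by rewrite ler_wpM2r //; have := eps_le1; lra.
  lra.
have sIr : s%:R <= #|I|%:R :> R by rewrite ler_nat.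
rewrite setDIr setDv set0U setIC setDIr setDv set0U; split.
  apply: le_trans (small _ d1) _; apply: ler_wpM2l sIr.
  by rewrite divr_ge0 // ltW.
apply: le_trans (small _ d2) _.
have h1 : #|I|%:R = #|I :&: B|%:R + #|I :\: B|%:R :> R by rewrite -natrD -(cardsID B I).
have h2 : #|I :&: B|%:R <= #|B|%:R :> R by rewrite ler_nat subset_leq_card // subsetIr.
have h3 := lin _ _ _ _ sIr h1 h2 (small _ d1).
have -> : eps / 16 * #|B|%:R = eps / 32 * (2 * #|B|%:R) by field.
by rewrite ler_wpM2l // divr_ge0 // ltW.
Qed.

(** The inner approximation [A' x B'] of the witness is a union of classes of level [k t] within one
    class of level [k], and its density is far from that of the class, so [class_gain] applies. *)
Lemma irregular_pair_gain I J : I \in P -> J \in P ->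
  ~~ interval_regular_pair eps Y I J ->
  eps ^+ 4 / 8 * s%:R ^+ 2 <=
    \sum_(p | block2 k p == (part_rank P I, part_rank P J)) f p ^+ 2.
Proof.
move=> IP JP /forallPn[A /forallPn[B]]; rewrite negb_imply -ltNge.
case/andP=> /and5P[intA intB AI BJ /andP[cA cB]] irr.
have [A' [A'A A'I A'c dA sA]] := approximate_side IP intA AI cA.
have [B' [B'B B'J B'c dB sB]] := approximate_side JP intB BJ cB.
set IB := block_set n k _ in A'I; set JB := block_set n k _ in B'J.
have [dI dIB] := part_block_ratios IP; have [dJ dJB] := part_block_ratios JP.
rewrite -/IB in dI dIB; rewrite -/JB in dJ dJB.
have e0 m : 0 <= eps / m%:R by rewrite divr_ge0 // ltW.
have g1 := density_subset_ratio Y01 A'A B'B dA dB (e0 _) (e0 _).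
have g2 := density_subset_ratio Y01 (subsetIl I IB) (subsetIl J JB) dI dJ (e0 _) (e0 _).
have g3 := density_subset_ratio Y01 (subsetIr I IB) (subsetIr J JB) dIB dJB (e0 _) (e0 _).
(* The comparisons [g1], [g2], [g3] cost [eps / 4], [eps / 16] and [eps / 8], together less than
   half of the deviation [eps]. *)
have far : eps / 2 <= `|density Y A' B' - density Y IB JB|.
  rewrite leNgt; apply/negP => near; move: irr; apply/negP; rewrite -leNgt.
  move: g1 g2 g3 near; rewrite ltr_norml !ler_norml => g1 g2 g3 near.
  by have := eps_gt0; lra.
have X0 : finset.setX A' B' \subset finset.setX IB JB by exact: setXS.
have ZE : finset.setX IB JB =
    [set p | block2 k p == (part_rank P I, part_rank P J)]%SET.
  by apply/setP => p; rewrite !inE.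
have Xc p q : block2 (k * t) p = block2 (k * t) q ->
    p \in finset.setX A' B' -> q \in finset.setX A' B'.
  by case=> e1 e2; rewrite !inE => /andP[/(A'c _ _ e1)-> /(B'c _ _ e2)->].
apply: le_trans (class_gain F ZE X0 Xc).
rewrite -!density_mean cardsX natrM -(real_normK (num_real (_ - _))).
set D := `|_|; rewrite -/D in far.
have s0 : 0 <= s%:R :> R by [].
have u0 : 0 <= 7 / 8 * eps * s%:R by rewrite mulr_ge0 // mulr_ge0 ?divr_ge0 // ltW.
(* [(7/8)^2 / 4 = 49/256] exceeds the required [1/8]. *)
apply: (@le_trans _ _ ((7 / 8 * eps * s%:R) * (7 / 8 * eps * s%:R) * (eps / 2) ^+ 2)).
  have -> : 7 / 8 * eps * s%:R * (7 / 8 * eps * s%:R) * (eps / 2) ^+ 2 =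
     49 / 256 * (eps ^+ 4 * s%:R ^+ 2) by field.
  have -> : eps ^+ 4 / 8 * s%:R ^+ 2 = 1 / 8 * (eps ^+ 4 * s%:R ^+ 2) by field.
  by rewrite ler_wpM2r ?mulr_ge0 ?exprn_ge0 ?(ltW eps_gt0) //; lra.
apply: ler_pM; [exact: mulr_ge0 | exact: sqr_ge0 | exact: ler_pM |].
by apply: lerXn2r far; rewrite nnegrE ?normr_ge0 // divr_ge0 // ltW.
Qed.

(** Distinct irregular pairs have distinct pairs of ranks, so their gains come from disjoint cells
    and add up. The constant 32 comes from [n <= k (s + 1) <= 2 k s]. *)
Lemma irregular_partition_gap : ~ interval_regular_partition eps Y P ->
  eps ^+ 5 / 32 * n%:R ^+ 2 < energy_gap F (block2 k) (block2 (k * t)).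
Proof.
move=> /negP; rewrite /interval_regular_partition -ltNge cardP.
set Bad := [set p in _ | _]%SET => many.
pose phi (p : {set 'I_n} * {set 'I_n}) := (part_rank P p.1, part_rank P p.2).
have BadP p : p \in Bad ->
  [/\ p.1 \in P, p.2 \in P & ~~ interval_regular_pair eps Y p.1 p.2].
  by rewrite !inE -andbA => /and3P[].
have phi_inj : {in Bad &, injective phi}.
  move=> [I J] [I' J'] /BadP[/= IP JP _] /BadP[/= IP' JP' _] [e1 e2].
  by rewrite (part_rank_inj partP IP IP' e1) (part_rank_inj partP JP JP' e2).
have low : #|Bad|%:R * (eps ^+ 4 / 8 * s%:R ^+ 2) <= energy_gap F (block2 k) (block2 (k * t)).
  apply: (@le_trans _ _ (\sum_(p in Bad) \sum_(x | block2 k x == phi p) f x ^+ 2)).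
    rewrite mulr_natl -sumr_const; apply: ler_sum => p /BadP[IP JP].
    exact: irregular_pair_gain.
  (* After swapping the sums, injectivity of [phi] says that each point [x] is counted for at most
     one irregular pair. *)
  rewrite (exchange_big_dep xpredT) //=; apply: ler_sum => x _.
  rewrite sumr_const -/(f x) -mulr_natr ler_piMr ?sqr_ge0 // -[1]/(1%:R) ler_nat.
  apply/card_le1_eqP => p q; rewrite !unfold_in => /andP[pB /eqP ep] /andP[qB /eqP eq].
  by apply: phi_inj => //; rewrite -ep -eq.
apply: lt_le_trans low.
have /andP[_ nk] := card_ord_bounds partP cardP sizeP.
have n2 : n%:R <= 2 * (k%:R * s%:R) :> R.
  rewrite -!natrM ler_nat; have := s_ge64; nia.
have ks : 0 < k%:R * s%:R :> R.
  by rewrite -natrM ltr0n muln_gt0 k_gt0 (leq_trans _ s_ge64).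
have s2 : 0 < s%:R ^+ 2 :> R by rewrite exprn_gt0 // ltr0n (leq_trans _ s_ge64).
apply: (@le_lt_trans _ _ (eps * k%:R ^+ 2 * (eps ^+ 4 / 8 * s%:R ^+ 2))).
  have -> : eps * k%:R ^+ 2 * (eps ^+ 4 / 8 * s%:R ^+ 2) =
      eps ^+ 5 / 32 * (2 * (k%:R * s%:R)) ^+ 2 by field.
  rewrite ler_wpM2l ?divr_ge0 ?exprn_ge0 ?(ltW eps_gt0) //.
  by apply: lerXn2r n2; rewrite nnegrE // mulr_ge0 // ltW.
by rewrite ltr_pM2r // mulr_gt0 // divr_gt0 // exprn_gt0.
Qed.

End Increment.

(** * Choice of a level at which the energy barely grows *)

Lemma exists_small_increment (R : realFieldType) (u : nat -> R) (N d : R) (T : nat) :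
  (0 < T)%N -> (forall i, 0 <= u i <= N) -> N <= T%:R * d ->
  exists2 i, (i < T)%N & u i.+1 - u i <= d.
Proof.
move=> T0 uN Nd; case: (boolP [exists i : 'I_T, u i.+1 - u i <= d]).
  by case/existsP=> i; exists i.
rewrite negb_exists => /forallP large.
(* If every increment exceeded [d], telescoping would push [u T] above [N]. *)
suff : T%:R * d < u T - u 0%N by have := uN T; have := uN 0%N; lra.
rewrite -telescope_sumr // big_mkord mulr_natl -[T in d *+ T]card_ord -sumr_const.
apply: ltr_sum => [|i _]; last by rewrite ltNge.
by apply/hasP; exists (Ordinal T0); rewrite ?mem_index_enum.
Qed.

(** The level depends only on the energies along [m t^i], so it is fixed before [P] and serves every
    equipartition with that many parts. *)
Lemma exists_regular_level (R : realType) (n : nat) (Y : 'M[R]_n) (eps : R) (m t T : nat) :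
  (forall i j, 0 <= Y i j <= 1) -> 0 < eps -> eps <= 1 -> (0 < m)%N ->
  64 <= eps ^+ 2 * t%:R -> (0 < T)%N -> 32 <= eps ^+ 5 * T%:R ->
  (2 * (m * t ^ T) ^ 2 <= n)%N ->
  exists2 i, (i < T)%N & forall P : {set {set 'I_n}},
    #|P| = (m * t ^ i)%N -> interval_equipartition P ->
    interval_regular_partition eps Y P.
Proof.
move=> Y01 e0 e1 m0 t64 T0 T32 nN.
have t0 : (0 < t)%N.
  by case: t t64 {nN} => // t64; exfalso; rewrite mulr0 in t64; lra.
pose F (p : 'I_n * 'I_n) := Y p.1 p.2.
have F01 p : 0 <= F p <= 1 by exact: Y01.
pose d := eps ^+ 5 / 32 * n%:R ^+ 2.
pose u i := energy F (block2 (m * t ^ i)).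
have uN i : 0 <= u i <= n%:R ^+ 2.
  by have := energy_bounds F01 (block2 (m * t ^ i)); rewrite card_prod !card_ord natrM.
have Nd : n%:R ^+ 2 <= T%:R * d.
  have -> : T%:R * d = (eps ^+ 5 * T%:R) / 32 * n%:R ^+ 2 by rewrite /d; ring.
  by rewrite ler_peMl ?sqr_ge0 // ler_pdivlMr // mul1r.
have [i iT gap] := exists_small_increment T0 uN Nd.
exists i => // P cardP [partP intP equiP].
have k0 : (0 < m * t ^ i)%N by rewrite muln_gt0 m0 expn_gt0 t0.
set k := (m * t ^ i)%N in cardP k0.
have [I0 I0P] : exists I0, I0 \in P by apply/card_gt0P; rewrite cardP.
case: (arg_minnP (fun I : {set 'I_n} => #|I|) I0P) => I1 I1P I1min.
set s := #|I1|.
have sizeP : {in P, forall I : {set 'I_n}, (s <= #|I| <= s.+1)%N}.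
  by move=> I IP; rewrite I1min //= equiP.
have /andP[_ nk] := card_ord_bounds partP cardP sizeP.
(* From [2 (k t)^2 <= n <= k (s + 1)] follows [s + 1 >= 2 k t^2 >= 2 k t], hence [s >= k t]. *)
have ks : (k * t <= s)%N.
  have kT : (k * t <= m * t ^ T)%N.
    by rewrite /k -mulnA -expnSr leq_mul2l leq_pexp2l ?orbT.
  have : (2 * (k * t) ^ 2 <= k * s.+1)%N.
    apply: leq_trans (leq_trans nN nk).
    by rewrite leq_mul2l leq_sqr.
  have -> : (2 * (k * t) ^ 2 = k * (2 * (k * t) * t))%N by rewrite -mulnn; ring.
  rewrite leq_pmul2l //.
  have kt : (k * t <= k * t * t)%N by rewrite leq_pmulr.
  have kt0 : (0 < k * t)%N by rewrite muln_gt0 k0.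
  rewrite -(mulnA 2); move: kt kt0.
  move: (k * t * t)%N (k * t)%N => b a; clear; lia.
apply: contraT => irr.
have := irregular_partition_gap Y01 e0 e1 partP intP cardP sizeP k0 t64 ks (negP irr).
rewrite energy_gapE; last by move=> p q; apply: block2_refine.
move: gap; rewrite /u expnSr mulnA -/k -/F -/d => gap.
by rewrite ltNge gap.
Qed.

(** * Comparison of the levels with the bound [M] *)

Lemma sqr_level_le_bound (R : realType) (eps : R) (m t T : nat) :
  0 < eps -> 3 * eps <= 2 -> (0 < m)%N ->
  t%:R <= 64 * eps ^- 2 + 1 -> T%:R <= 32 * eps ^- 5 + 1 -> (1 < t)%N ->
  (2 * (m * t ^ T) ^ 2)%N%:R <= m%:R `^ 1000 * eps `^ (- 1000 * eps ^- 5).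
Proof.
move=> e0 e23 m0 tb Tb t1.
pose x := eps^-1.
have x32 : 3 / 2 <= x by rewrite /x -[eps^-1]div1r ler_pdivlMr //; lra.
have x1 : 1 <= x by lra.
rewrite -!exprVn -/x in tb Tb *.
have -> : eps `^ (- 1000 * x ^+ 5) = x `^ (1000 * x ^+ 5).
  by rewrite /x -(powR_inv1 (ltW e0)) -powRrM mulN1r mulNr.
have px i : 1 <= x ^+ i by rewrite exprn_ege1.
(* [t <= 65 x^2], and [65 <= (3/2)^11 <= x^11]. *)
have t13 : t%:R <= x ^+ 13.
  apply: (le_trans tb); apply: (@le_trans _ _ (65 * x ^+ 2)); first by have := px 2; lra.
  rewrite (exprD x 11 2) ler_wpM2r ?exprn_ge0 //; first lra.
  apply: (@le_trans _ _ ((3 / 2) ^+ 11)); first by rewrite !exprS expr0; lra.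
  by rewrite lerXn2r // nnegrE; lra.
have T33 : T%:R <= 33 * x ^+ 5 by have := px 5; lra.
(* The factor 2 is absorbed by one more factor [t]. *)
apply: (@le_trans _ _ (m%:R ^+ 2 * t%:R ^+ (2 * T).+1)).
  rewrite -!natrX -natrM ler_nat expnMn (expnS t (2 * T)) mulnCA leq_mul2l.
  by rewrite -expnM (mulnC T) leq_mul2r t1 !orbT.
apply: ler_pM; rewrite ?exprn_ge0 //.
  rewrite -powR_mulrn // ler_powR //; first by rewrite ler1n.
  by rewrite ler_nat.
apply: (@le_trans _ _ ((x ^+ 13) ^+ (2 * T).+1)).
  by rewrite lerXn2r // nnegrE ?exprn_ge0 //; lra.
rewrite -exprM -powR_mulrn; last by lra.
(* The exponent is [13 (2 T + 1) <= 13 (66 x^5 + 1) <= 871 x^5], below [1000 x^5]. *)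
apply: ler_powR => //; rewrite natrM -[(2 * T).+1%:R]natr1 natrM.
have := px 5; lra.
Qed.

(** This serves the choice [k = m]. If [eps > 1] the second factor is below 1, and half of the
    exponent of [m >= 2] makes up for it. *)
Lemma nat_le_bound (R : realType) (eps : R) (m : nat) : 0 < eps -> (0 < m)%N ->
  eps <= 1 \/ (1 < m)%N ->
  m%:R <= m%:R `^ 1000 * eps `^ (- 1000 * eps ^- 5).
Proof.
move=> e0 m0 em.
have m1 : 1 <= m%:R :> R by rewrite ler1n.
have mle : m%:R <= m%:R `^ 500 :> R by rewrite le1r_powR //; lra.
have [e1|e1] := leP eps 1.
  have E1 : 1 <= eps `^ (- 1000 * eps ^- 5).
    rewrite /powR gt_eqF // -[leLHS]expR0 ler_expR.
    have : eps ^- 5 * ln eps <= 0.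
      by rewrite mulr_ge0_le0 ?ln_le0 // invr_ge0 exprn_ge0 // ltW.
    by rewrite -mulrA; move: (_ * ln eps) => z; lra.
  apply: (@le_trans _ _ (m%:R `^ 1000)); first by rewrite le1r_powR //; lra.
  by rewrite ler_peMr // powR_ge0.
have m2 : 2 <= m%:R :> R by rewrite ler_nat; case: em => // ; rewrite leNgt e1.
have lnm : 1 / 2 <= ln m%:R :> R.
  (* [ln (1 + z) <= z] at [z = -1/2] gives [ln 2 >= 1/2]. *)
  have l2 : ln 2^-1 <= - 2^-1 :> R.
    have half : 2^-1 = 1 + - 2^-1 :> R by field.
    by rewrite [in leLHS]half; apply: le_ln1Dx; lra.
  rewrite lnV ?posrE // in l2.
  have : ln 2 <= ln m%:R :> R by rewrite ler_ln ?posrE // (lt_le_trans _ m2).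
  lra.
(* [ln eps <= eps - 1 <= eps^2 / 4 <= eps^5 / 4]. *)
have lne : eps ^- 5 * ln eps <= 1 / 4.
  rewrite mulrC ler_pdivrMr ?exprn_gt0 //.
  have := @le_ln1Dx _ (eps - 1) ltac:(lra); rewrite addrC subrK => le1.
  apply: (le_trans le1); apply: (@le_trans _ _ (1 / 4 * eps ^+ 2)).
    have := sqr_ge0 (eps - 2); rewrite sqrrB; lra.
  by apply: ler_wpM2l; [lra | rewrite ler_eXn2l].
(* The two estimates balance exactly: [500 / 2 = 1000 / 4]. *)
have E1 : 1 <= m%:R `^ 500 * eps `^ (- 1000 * eps ^- 5).
  rewrite /powR !gt_eqF // ?(lt_le_trans _ m1) // -expRD -[leLHS]expR0 ler_expR.
  by rewrite -mulrA; move: lne; move: (_ * ln eps) => z; lra.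
have -> : m%:R `^ 1000 = m%:R `^ 500 * m%:R `^ 500 :> R.
  have -> : 1000 = 500 + 500 :> R by ring.
  by rewrite powRD //; apply/implyP => _; rewrite pnatr_eq0 -lt0n.
apply: (le_trans mle); rewrite -mulrA; apply: ler_peMr E1; exact: powR_ge0.
Qed.

(** * Assembly: choice of [t], [T] and [k] *)

Theorem theorem7p3 (R : realType) :
  exists C : R, 0 < C /\
    forall (eps : R) (m : nat), 0 < eps -> (0 < m)%N ->
    (* for eps > 1 and m = 1 the bound M is < 1, so [m, M] is empty *)
    eps <= 1 \/ (1 < m)%N ->
    forall (n : nat) (Y : 'M[R]_n), (forall i j, 0 <= Y i j <= 1) ->
    exists k : nat,
      [/\ (m <= k)%N,
          k%:R <= m%:R `^ C * eps `^ (- C * eps ^- 5)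
        & forall P : {set {set 'I_n}},
            #|P| = k -> interval_equipartition P ->
            interval_regular_partition eps Y P].
Proof.
exists 1000; split=> // eps m e0 m0 em n Y Y01.
have [e23|e23] := leP 2 (3 * eps).
  exists m; split=> //; first exact: nat_le_bound.
  move=> P _ [partP _ _]; rewrite /interval_regular_partition.
  set Bad := [set p in _ | _]%SET; suff -> : Bad = finset.set0.
    by rewrite cards0 mulr_ge0 ?exprn_ge0 // ltW.
  apply/eqP/set0Pn => -[p]; rewrite !inE => /andP[/andP[IP JP] /negP[]].
  by apply: regular_pair_of_ge; rewrite ?(part_neq0 partP).
have e1 : eps <= 1 by lra.
have ge0 i : 0 <= eps ^- i by rewrite invr_ge0 exprn_ge0 // ltW.
(* The successor of the truncation exceeds the real value by at most 1. [T] gains of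
   [eps^5 n^2 / 32] exhaust the maximal energy [n^2]. *)
pose t := (Num.truncn (64 * eps ^- 2)).+1.
pose T := (Num.truncn (32 * eps ^- 5)).+1.
have /andP[t_le t_gt] := truncn_itv (mulr_ge0 (ler0n R 64) (ge0 2%N)).
have /andP[T_le T_gt] := truncn_itv (mulr_ge0 (ler0n R 32) (ge0 5%N)).
rewrite -/t -/T in t_gt T_gt.
have t64 : 64 <= eps ^+ 2 * t%:R.
  by rewrite mulrC -ler_pdivrMr ?exprn_gt0 // ltW.
have T32 : 32 <= eps ^+ 5 * T%:R.
  by rewrite mulrC -ler_pdivrMr ?exprn_gt0 // ltW.
have t1 : (1 < t)%N.
  rewrite -(ltr_nat R); apply: (@lt_le_trans _ _ 64); first by rewrite ltr_nat.
  by apply: le_trans t64 _; rewrite ler_piMl // expr_le1 // ltW.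
have bound : (2 * (m * t ^ T) ^ 2)%N%:R <= m%:R `^ 1000 * eps `^ (- 1000 * eps ^- 5).
  by apply: sqr_level_le_bound; rewrite ?(ltW e23) // -[leLHS]natr1 lerD2r.
have tpos i : (0 < t ^ i)%N by rewrite expn_gt0.
have le_levels i : (i <= T)%N -> (m * t ^ i <= 2 * (m * t ^ T) ^ 2)%N.
  move=> iT; apply: (@leq_trans (m * t ^ T)).
    by rewrite leq_mul2l leq_pexp2l ?orbT.
  have a0 : (0 < m * t ^ T)%N by rewrite muln_gt0 m0 tpos.
  by rewrite -mulnn mulnA leq_pmull // muln_gt0.
have [nN|nN] := leqP (2 * (m * t ^ T) ^ 2) n.
  have [i iT reg] := exists_regular_level Y01 e0 e1 m0 t64 (ltn0Sn _) T32 nN.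
  exists (m * t ^ i)%N; split=> //; first by rewrite leq_pmulr.
  by apply: le_trans bound; rewrite ler_nat le_levels // ltnW.
(* More than [n] nonempty parts do not fit into [[n]], so the condition on [P] is vacuous. *)
exists (2 * (m * t ^ T) ^ 2)%N; split=> //.
  by have := le_levels 0%N isT; rewrite muln1.
move=> P cardP [partP _ _]; have := card_part_le partP.
by rewrite cardP leqNgt nN.
Qed.
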